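(* Let $G=(V,E,\mathbf{w}_0)$ be a connected finite weighted graph with $E=\{e_1,\dots,e_m\}$ and initial weight $\mathbf{w}_0=(w_{0,e})_{e\in E}\in\mathbb{R}_+^m$. Fix a step size $s>0$ and let $t_j=js$ for $j=0,1,2,\dots$. Then for any $\alpha\in(0,1)$, the discrete local entropy flow $$\begin{cases} w_e(t_{j+1})=w_e(t_j)+s\,\Theta_e^\alpha(t_j),\\ w_e(t_j)>0,\quad j=0,1,2,\dots,\\ w_e(0)=w_{0,e}, \end{cases}\qquad \forall e\in E,$$ where $\Theta_e^\alpha(t_j)$ is the edge entropy of $e$ computed with respect to the weight vector $\mathbf{w}(t_j)=(w_e(t_j))_{e\in E}$, admits a unique solution $\mathbf{w}(t_j)=(w_e(t_j))_{e\in E}$ for all $j=0,1,2,\dots$. Moreover, exactly one of the following two alternatives holds: (i) For every $e\in E$, $w_e(t_j)$ is non-decreasing in $j$ and $\lim_{j\to+\infty}w_e(t_j)=+\infty$; (ii) For every $e\in E$, $w_e(t_j)$ is non-decreasing in $j$ and converges to some positive (finite) limit $w_e^\ast>0$ as $j\to+\infty$; in this case, $\lim_{j\to+\infty}\Theta_e^\alpha(t_j)=0$ for all $e\in E$.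
   Context: $\mathbb{R}_+^m=\{\mathbf{a}=(a_1,\dots,a_m)\in\mathbb{R}^m: a_j>0 \text{ for all } 1\le j\le m\}$. A connected finite weighted graph $G=(V,E,\mathbf{w})$ is a finite connected simple undirected graph with vertex set $V=\{x_1,\dots,x_n\}$, edge set $E=\{e_1,\dots,e_m\}$ ($m\ge 1$), and edge weights $\mathbf{w}=(w_e)_{e\in E}$, $w_e>0$ for all $e$. Write $x\sim y$ if $x,y$ are adjacent, $xy$ for the edge joining them, and $w_{xy}=w_{yx}$ for its weight. For $x\in V$ let $\mathscr{N}_x=\{u\in V: u\sim x \text{ or } u=x\}$. Local random walks. Fix $\alpha\in(0,1)$, a weight vector $\mathbf{w}$, and an edge $e=xy$. The local random walk starting from $x$ associated with $e=xy$ is the probability measure $\mu_x^\alpha:V\to[0,1]$ defined as follows. If $\mathscr{N}_y\setminus\mathscr{N}_x\neq\emptyset$, $$\mu_x^\alpha(z)=\begin{cases}\alpha, & z=x,\\ \alpha(1-\alpha)\dfrac{w_{xz}}{\sum_{u\sim x}w_{xu}}, & z\sim x,\\ (1-\alpha)^2\dfrac{w_{yz}}{\sum_{u\in\mathscr{N}_y\setminus\mathscr{N}_x}w_{yu}}, & z\in\mathscr{N}_y\setminus\mathscr{N}_x,\\ 0, & \text{otherwise.}\end{cases}$$ If $\mathscr{N}_y\setminus\mathscr{N}_x=\emptyset$, $$\mu_x^\alpha(z)=\begin{cases}\alpha, & z=x,\\ (1-\alpha)\dfrac{w_{xz}}{\sum_{u\sim x}w_{xu}}, & z\sim x,\\ 0,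 & \text{otherwise.}\end{cases}$$ The walk $\mu_y^\alpha$ starting from $y$ associated with $e$ is defined by the same formulas with the roles of $x$ and $y$ exchanged. Both measures depend on the edge $e$ and on $\mathbf{w}$, and each is strictly positive exactly on $\mathscr{N}_x\cup\mathscr{N}_y$. Edge entropy. For $e=xy\in E$, with $\mu_x^\alpha,\mu_y^\alpha$ the two local random walks associated with $e$, $$\Theta_e^\alpha=\sum_{z\in\mathscr{N}_x\cup\mathscr{N}_y}\left(\mu_x^\alpha(z)\log\frac{\mu_x^\alpha(z)}{\mu_y^\alpha(z)}+\mu_y^\alpha(z)\log\frac{\mu_y^\alpha(z)}{\mu_x^\alpha(z)}\right).$$ *)

(* Defs.v *)
From HB Require Import structures.
From mathcomp Require Import all_boot all_order all_algebra.
From mathcomp Require Import all_classical all_reals all_analysis.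

Set Implicit Arguments.
Unset Strict Implicit.
Unset Printing Implicit Defensive.

Import Order.TTheory GRing.Theory Num.Theory.
Import numFieldNormedType.Exports.

Local Open Scope ring_scope.

Record sgraph (V : finType) := SGraph {
  adj : rel V;
  adj_sym : symmetric adj;
  adj_irr : irreflexive adj }.

Definition connected_graph (V : finType) (G : sgraph V) : Prop :=
  forall x y : V, connect (adj G) x y.

(* An edge is the unordered pair of its endpoints. *)
Definition edges (V : finType) (G : sgraph V) : {set {set V}} :=
  [set [set p.1; p.2] | p : V * V & adj G p.1 p.2]%SET.

Definition edge (V : finType) (G : sgraph V) : Type :=
  {e : {set V} | e \in edges G}.

Section EdgeEntropy.
Variables (R : realType) (V : finType) (G : sgraph V).
Implicit Types (a : R) (w : edge G -> R) (x y z : V).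

(* The value off the edge set is junk: only adjacent pairs matter below. *)
Definition weight w x y : R :=
  if (insub [set x; y]%SET : option (edge G)) is Some e then w e else 0.

Lemma weightE w (e : edge G) x y : val e = [set x; y]%SET -> weight w x y = w e.
Proof. by move=> exy; rewrite /weight -exy valK. Qed.

Definition nbhd x : {set V} := [set u | adj G u x || (u == x)]%SET.

(* The walk starting from x associated with the edge xy; the one starting from
   y associated with the same edge is [local_walk a w y x]. *)
Definition local_walk a w x y z : R :=
  if nbhd y :\: nbhd x != finset.set0 then
    if z == x then a
    else if adj G x z then
      a * (1 - a) * (weight w x z / \sum_(u | adj G u x) weight w x u)
    else if z \in nbhd y :\: nbhd x then
      (1 - a) ^+ 2 *
        (weight w y z / \sum_(u in nbhd y :\: nbhd x) weight w y u)
    else 0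
  else
    if z == x then a
    else if adj G x z then
      (1 - a) * (weight w x z / \sum_(u | adj G u x) weight w x u)
    else 0.

Definition pair_entropy a w x y : R :=
  let mux := local_walk a w x y in
  let muy := local_walk a w y x in
  \sum_(z in nbhd x :|: nbhd y)
    (mux z * ln (mux z / muy z) + muy z * ln (muy z / mux z)).

Lemma pair_entropyC a w x y : pair_entropy a w x y = pair_entropy a w y x.
Proof.
by rewrite /pair_entropy finset.setUC; apply: eq_bigr => z _; rewrite addrC.
Qed.

Lemma edge_endsP (e : edge G) :
  exists p : V * V, adj G p.1 p.2 && (val e == [set p.1; p.2]%SET).
Proof.
by case/imsetP: (valP e) => p; rewrite inE => Gp ->; exists p; rewrite Gp eqxx.
Qed.

Definition edge_ends (e : edge G) : V * V := xchoose (edge_endsP e).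

(* By [edge_entropyE], this does not depend on the order in which the
   endpoints are chosen. *)
Definition edge_entropy a w (e : edge G) : R :=
  pair_entropy a w (edge_ends e).1 (edge_ends e).2.

Lemma edge_entropyE a w (e : edge G) x y :
  val e = [set x; y]%SET -> edge_entropy a w e = pair_entropy a w x y.
Proof.
rewrite /edge_entropy /edge_ends; have := xchooseP (edge_endsP e).
case: (xchoose _) => u v /= /andP[Guv /eqP ->] Euv.
have uv : u != v by apply: contraTneq Guv => ->; rewrite adj_irr.
have: u \in [set x; y]%SET by rewrite -Euv !inE eqxx.
have: v \in [set x; y]%SET by rewrite -Euv !inE eqxx orbT.
rewrite !inE => /orP[] /eqP Ev /orP[] /eqP Eu; subst u v => //.
- by rewrite eqxx in uv.
- by rewrite pair_entropyC.
- by rewrite eqxx in uv.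
Qed.

End EdgeEntropy.

(* The weight vector at time t_j = j * s is [w j]. *)
Definition entropy_flow (R : realType) (V : finType) (G : sgraph V)
    (a s : R) (w0 : edge G -> R) (w : nat -> edge G -> R) : Prop :=
  [/\ forall j e, w j.+1 e = w j e + s * edge_entropy a (w j) e,
      forall j e, 0 < w j e
    & forall e, w 0%N e = w0 e].

(* Main.v *)
Require Import Defs.
From HB Require Import structures.
From mathcomp Require Import all_boot all_order all_algebra.
From mathcomp Require Import all_classical all_reals all_analysis.
From mathcomp Require Import ring lra.

Set Implicit Arguments.
Unset Strict Implicit.
Unset Printing Implicit Defensive.

Import Order.TTheory GRing.Theory Num.Theory.
Import numFieldNormedType.Exports.

Local Open Scope classical_set_scope.
Local Open Scope ring_scope.

(** The entropy of an edge is a sum of terms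
[(p - q) * (ln p - ln q) >= 0] (symmetrised Kullback-Leibler divergence), so
the weights can only grow: they stay positive, the recursion never breaks down,
and each weight either converges or tends to [+oo].

The point is that convergence of one weight forces convergence of all.  Let
[xy] be an edge with converging weight.  Its entropy is the increment of that
weight divided by the step, hence tends to [0].  Keep only the term of the
entropy at the vertex [x]: there the walk from [x] has the fixed mass [a],
whereas the walk from [y] has a mass [q <= w_xy / deg y], with [deg y] the
weighted degree.  Since the term is at least [(a - q)^2], eventually
[q >= a / 2], that is, [deg y <= (2 / a) * w_xy] ([degree_le_weight]).  Every
edge at [y] is therefore bounded, hence convergent, and by symmetry so is
every edge at [x] ([cvg_incident_edges]).  By connectedness this spreads to the
whole graph ([cvg_all_edges]). *)

(** * The symmetrised divergence of two numbers *)

Section SymmetrisedDivergence.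
Variable R : realType.
Implicit Types p q M : R.

Lemma sym_divergenceE p q : 0 < p -> 0 < q ->
  p * ln (p / q) + q * ln (q / p) = (p - q) * (ln p - ln q).
Proof. by move=> p0 q0; rewrite !ln_div ?posrE//; ring. Qed.

(** On [(0, M]] the derivative of [ln] is at least [1 / M], so [ln] spreads
points by at least that factor.  A general [M] serves both the sign of the
entropy, where any upper bound of [p] and [q] will do, and its quantitative
lower bound, where [M = 1]. *)
Lemma sqr_le_sym_divergence p q M : 0 < p -> 0 < q -> p <= M -> q <= M ->
  (p - q) ^+ 2 <= M * (p * ln (p / q) + q * ln (q / p)).
Proof.
wlog qp : p q / q <= p => [hwlog p0 q0 pM qM|].
  have [/hwlog->//|/ltW pq] := leP q p.
  by rewrite -sqrrN opprB [X in M * X]addrC; exact: hwlog.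
move=> p0 q0 pM qM; rewrite sym_divergenceE//.
have lnpq : p - q <= p * (ln p - ln q).
  have : ln (q / p) <= q / p - 1.
    have := @le_ln1Dx R (q / p - 1); rewrite [1 + _]addrC subrK; apply.
    by rewrite ltrBrDr addNr divr_gt0.
  rewrite ln_div ?posrE// -(ler_pM2l p0) [X in _ <= X]mulrBr mulr1.
  by rewrite [p * (q / p)]mulrC divfK ?gt_eqF//; lra.
rewrite mulrCA expr2 ler_wpM2l ?subr_ge0// (le_trans lnpq)//.
by rewrite ler_wpM2r// subr_ge0 ler_ln ?posrE.
Qed.

Lemma sym_divergence_ge0 p q : 0 <= p -> 0 <= q ->
  0 <= p * ln (p / q) + q * ln (q / p).
Proof.
rewrite [0 <= p]le_eqVlt [0 <= q]le_eqVlt.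
(* Off the common support the logarithms have the junk value [ln 0 = 0]. *)
case/predU1P => [<- _|p0].
  by rewrite invr0 !(mulr0, mul0r) ln0// mulr0 addr0.
case/predU1P => [<-|q0].
  by rewrite invr0 !(mulr0, mul0r) ln0// mulr0 addr0.
rewrite -(pmulr_rge0 _ (addr_gt0 p0 q0)).
apply: le_trans (sqr_ge0 (p - q)) _.
by apply: sqr_le_sym_divergence => //; rewrite ?lerDl ?lerDr ltW.
Qed.

End SymmetrisedDivergence.

(** * Lower bounds for the edge entropy *)

Section EdgeEntropyBounds.
Variables (R : realType) (V : finType) (G : sgraph V) (a : R).
Hypotheses (a_gt0 : 0 < a) (a_lt1 : a < 1).
Implicit Types (x y z : V) (e f : edge G).

Lemma adj_edge x y : adj G x y -> exists e : edge G, val e = [set x; y]%SET.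
Proof.
move=> xy; suff xyE : [set x; y]%SET \in edges G.
  by exists (exist (fun E => E \in edges G) _ xyE).
by apply/imsetP; exists (x, y); rewrite ?inE.
Qed.

Lemma edge_adj e : exists x y, adj G x y /\ val e = [set x; y]%SET.
Proof. by have [[x y] /andP[xy /eqP ?]] := edge_endsP e; exists x, y. Qed.

Variable w : edge G -> R.
Hypothesis w_gt0 : forall e, 0 < w e.

Lemma weight_ge0 x y : 0 <= weight w x y.
Proof. by rewrite /weight; case: insub => // e; exact: ltW. Qed.

Lemma weight_gt0 x y : adj G x y -> 0 < weight w x y.
Proof. by case/adj_edge => e /(weightE w) ->. Qed.

Lemma weight_le_degree x y : adj G x y ->
  weight w x y <= \sum_(u | adj G u x) weight w x u.
Proof.
move=> xy; rewrite (bigD1 y) ?[adj G y x]adj_sym//= lerDl sumr_ge0// => u _.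
exact: weight_ge0.
Qed.

Lemma local_walk_ge0 x y z : 0 <= local_walk a w x y z.
Proof.
have [a0 b0] : 0 <= a /\ 0 <= 1 - a by rewrite subr_ge0 !ltW.
have ratio0 (P : pred V) u v : 0 <= weight w u v / \sum_(t | P t) weight w u t.
  by rewrite divr_ge0 ?sumr_ge0// => *; exact: weight_ge0.
rewrite /local_walk; do !case: ifP => // _;
  by do ?[exact: ratio0 | apply: mulr_ge0 | apply: exprn_ge0].
Qed.

Lemma local_walk_start x y : local_walk a w x y x = a.
Proof. by rewrite /local_walk eqxx; case: ifP. Qed.

(** The two shapes of the walk only differ here by the factor in front of the
transition probability, [a * (1 - a)] or [1 - a]; both lie in [(0, 1)]. *)
Lemma local_walk_neighbor x y z : adj G x z ->
  0 < local_walk a w x y z <=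
      weight w x z / \sum_(u | adj G u x) weight w x u.
Proof.
move=> xz; set D := \sum_(u | _) _.
have D0 : 0 < D := lt_le_trans (weight_gt0 xz) (weight_le_degree xz).
have r0 : 0 < weight w x z / D by rewrite divr_gt0 ?weight_gt0.
have zx : (z == x) = false by apply: contraTF xz => /eqP ->; rewrite adj_irr.
have b0 : 0 < 1 - a by rewrite subr_gt0.
have b1 : 1 - a <= 1 by rewrite gerBl ltW.
rewrite /local_walk zx xz -/D; move: (weight w x z / D) r0 => r r0.
case: ifP => _.
  by rewrite !mulr_gt0//= ger_pMl// mulr_ile1// ltW.
by rewrite mulr_gt0//= ger_pMl.
Qed.

Lemma pair_entropy_ge0 x y : 0 <= pair_entropy a w x y.
Proof.
by apply: sumr_ge0 => z _; apply: sym_divergence_ge0; exact: local_walk_ge0.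
Qed.

Lemma edge_entropy_ge0 e : 0 <= edge_entropy a w e.
Proof. exact: pair_entropy_ge0. Qed.

(** The vertex [x] is singled out because the walk from [x] has mass [a] there
whatever the weights are; both masses are at most [1], and the other terms of
the entropy are nonnegative. *)
Lemma sqr_le_pair_entropy x y : adj G x y ->
  (a - local_walk a w y x x) ^+ 2 <= pair_entropy a w x y.
Proof.
move=> xy; have yx : adj G y x by rewrite adj_sym.
have /andP[q0 qr] := local_walk_neighbor x yx.
have q1 : local_walk a w y x x <= 1.
  apply: le_trans qr _; rewrite ler_pdivrMr ?mul1r ?weight_le_degree//.
  exact: lt_le_trans (weight_gt0 yx) (weight_le_degree yx).
have := sqr_le_sym_divergence a_gt0 q0 (ltW a_lt1) q1; rewrite mul1r.
move=> /le_trans; apply.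
rewrite /pair_entropy (bigD1 x) ?inE ?eqxx ?orbT//= local_walk_start lerDl.
by apply: sumr_ge0 => z _; apply: sym_divergence_ge0; exact: local_walk_ge0.
Qed.

(** Small entropy keeps the mass at [x] of the walk from [y] close to [a],
so that the edge carries a definite proportion of the degree of [y]. *)
Lemma degree_le_weight x y : adj G x y ->
  pair_entropy a w x y < (a / 2) ^+ 2 ->
  \sum_(u | adj G u y) weight w y u <= 2 / a * weight w y x.
Proof.
move=> xy small; have yx : adj G y x by rewrite adj_sym.
have D0 := lt_le_trans (weight_gt0 yx) (weight_le_degree yx).
have /andP[_ qr] := local_walk_neighbor x yx.
have a20 : 0 < a / 2 by rewrite divr_gt0.
have : a / 2 <= local_walk a w y x x.
  have := le_lt_trans (sqr_le_pair_entropy xy) small.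
  rewrite -[X in X < _]real_normK ?num_real// ltr_pXn2r ?nnegrE ?(ltW a20)//.
  by move/(le_lt_trans (ler_norm _)); lra.
move=> /le_trans/(_ qr); rewrite ler_pdivlMr// => aD.
by rewrite -[2 / a]invf_div mulrC ler_pdivlMr// mulrC.
Qed.

Lemma incident_weight_le e f x y : val e = [set x; y]%SET -> adj G x y ->
  y \in val f -> edge_entropy a w e < (a / 2) ^+ 2 -> w f <= 2 / a * w e.
Proof.
move=> exy xy yf; rewrite (edge_entropyE _ _ exy) => /(degree_le_weight xy).
rewrite (weightE w (e := e)) ?exy 1?finset.setUC//.
apply: le_trans.
have [u yu fE] : exists2 u, adj G y u & val f = [set y; u]%SET.
  have [p [q [pq fE]]] := edge_adj f; move: yf; rewrite fE !inE.
  case/orP => /eqP ->; first by exists q.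
  by exists p; rewrite 1?adj_sym// finset.setUC.
by rewrite -(weightE w fE) weight_le_degree.
Qed.

End EdgeEntropyBounds.

(** * Existence and uniqueness of the flow *)

Section Flow.
Variables (R : realType) (V : finType) (G : sgraph V) (a s : R).
Hypotheses (a_gt0 : 0 < a) (a_lt1 : a < 1) (s_gt0 : 0 < s).
Implicit Types (e f g h : edge G) (w : nat -> edge G -> R).

Lemma entropy_flow_exists_unique (w0 : edge G -> R) : (forall e, 0 < w0 e) ->
  exists! w, entropy_flow a s w0 w.
Proof.
move=> w0_gt0.
pose step (v : edge G -> R) e := v e + s * edge_entropy a v e.
exists (fun j => iter j step w0); split.
  split=> //; elim=> [|j IHj] e; first exact: w0_gt0.
  apply: ltr_pwDl; first exact: IHj.
  by rewrite mulr_ge0 ?edge_entropy_ge0// ltW.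
move=> w [wS _ wz]; apply/funext; elim=> [|j IHj]; apply/funext => e.
  by rewrite wz.
by rewrite wS /= IHj.
Qed.

(** * Long-time behaviour *)

Variables (w0 : edge G -> R) (w : nat -> edge G -> R).
Hypothesis flow_w : entropy_flow a s w0 w.

Lemma flow_nondecreasing e : nondecreasing_seq (w ^~ e).
Proof.
case: flow_w => wS w_gt0 _; apply/nondecreasing_seqP => j.
by rewrite wS lerDl mulr_ge0 ?edge_entropy_ge0// ltW.
Qed.

(** Up to the factor [s], the entropy is the increment of the weight. *)
Lemma flow_entropy_cvg0 e : cvgn (w ^~ e) ->
  (fun j => edge_entropy a (w j) e) @ \oo --> (0 : R).
Proof.
case: flow_w => wS _ _ cvg_we.
have -> : (fun j => edge_entropy a (w j) e) =
          (fun j => s^-1 * (w j.+1 e - w j e)).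
  by apply/funext => j; rewrite wS addrC addKr mulKf// gt_eqF.
rewrite -(mulr0 s^-1) -(subrr (limn (w ^~ e))).
by apply: cvgMr; apply: cvgB => //; rewrite (cvg_shiftS (w ^~ e)).
Qed.

(** Along a converging edge the entropy is eventually small, so the weight of
an incident edge is at most a constant multiple of a bounded one. *)
Lemma cvg_incident_edges e f x y : val e = [set x; y]%SET -> adj G x y ->
  cvgn (w ^~ e) -> y \in val f -> cvgn (w ^~ f).
Proof.
move=> exy xy cvg_we yf; have w_gt0 : forall j e, 0 < w j e by case: flow_w.
apply: nondecreasing_is_cvgn; first exact: flow_nondecreasing.
have : \forall j \near \oo, edge_entropy a (w j) e < (a / 2) ^+ 2.
  by apply: (cvgr_lt _ (flow_entropy_cvg0 cvg_we)); rewrite exprn_gt0 ?divr_gt0.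
case=> N _ small; exists (2 / a * limn (w ^~ e)) => _ [j _ <-].
(* The estimate holds from [N] on; monotonicity transfers it to the others. *)
have /le_trans : w j f <= w (maxn N j) f.
  by rewrite flow_nondecreasing ?leq_maxr.
apply; have /small/= := leq_maxl N j.
move/(incident_weight_le a_gt0 a_lt1 (w_gt0 _) exy xy yf)/le_trans; apply.
rewrite ler_wpM2l ?divr_ge0 ?(ltW a_gt0)//.
exact: nondecreasing_cvgn_le (flow_nondecreasing e) cvg_we _.
Qed.

(** The property that all edges at a vertex converge passes from a vertex to its
neighbours, through the edge that joins them. *)
Lemma cvg_all_edges e f : connected_graph G -> cvgn (w ^~ e) -> cvgn (w ^~ f).
Proof.
move=> Gconn cvg_we.
have [x [y [xy exy]]] := edge_adj e; have [u [v [uv fuv]]] := edge_adj f.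
have cvg_at g p : cvgn (w ^~ g) -> p \in val g ->
    forall h, p \in val h -> cvgn (w ^~ h).
  move=> cvg_wg pg h; have [b [c [bc gbc]]] := edge_adj g.
  move: pg; rewrite gbc !inE => /orP[] /eqP ->.
    by apply: cvg_incident_edges cvg_wg; rewrite ?gbc 1?finset.setUC// adj_sym.
  exact: cvg_incident_edges gbc bc cvg_wg.
have : forall h, x \in val h -> cvgn (w ^~ h).
  by apply: cvg_at cvg_we _; rewrite exy !inE eqxx.
have /connectP[p] := Gconn x u.
elim: p x {xy exy} => [|z p IHp] x /= => [_ <-|/andP[xz pz] lastp] cvg_x.
  by apply: cvg_x; rewrite fuv !inE eqxx.
apply: (IHp z) => //; have [g gxz] := adj_edge xz.
have zg : z \in val g by rewrite gxz !inE eqxx orbT.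
by apply: cvg_at zg; apply: cvg_x; rewrite gxz !inE eqxx.
Qed.

End Flow.

Theorem theorem2p2 (R : realType) (V : finType) (G : sgraph V)
    (Gconn : connected_graph G) (Gedge : (0 < #|edges G|)%N)
    (w0 : edge G -> R) (w0_gt0 : forall e : edge G, 0 < w0 e)
    (s : R) (s_gt0 : 0 < s) (a : R) (a_gt0 : 0 < a) (a_lt1 : a < 1) :
  (exists! w : nat -> edge G -> R, entropy_flow a s w0 w) /\
  (forall w : nat -> edge G -> R, entropy_flow a s w0 w ->
     let alt1 := forall e : edge G,
       nondecreasing_seq (fun j => w j e) /\
       (fun j => w j e) @ \oo --> +oo in
     let alt2 := forall e : edge G,
       nondecreasing_seq (fun j => w j e) /\
       (exists2 l : R, 0 < l & (fun j => w j e) @ \oo --> l) in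
     [/\ alt1 \/ alt2,
         ~ (alt1 /\ alt2)
       & alt2 -> forall e : edge G,
           (fun j => edge_entropy a (w j) e) @ \oo --> (0 : R)]).
Proof.
split; first exact: entropy_flow_exists_unique.
move=> w flow_w alt1 alt2.
have nd := flow_nondecreasing a_gt0 a_lt1 s_gt0 flow_w.
have w_gt0 : forall j e, 0 < w j e by case: flow_w.
split.
- have [[e cvg_we]|no_cvg] := pselect (exists e, cvgn (w ^~ e)).
    right=> f; split; first exact: nd.
    have cvg_wf : cvgn (w ^~ f).
      exact: (cvg_all_edges a_gt0 a_lt1 s_gt0 flow_w Gconn cvg_we).
    exists (limn (w ^~ f)) => //; apply: lt_le_trans (w_gt0 0%N f) _.
    exact: nondecreasing_cvgn_le (nd f) cvg_wf 0%N.
  left=> e; split; first exact: nd.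
  apply: nondecreasing_dvgn_lt; first exact: nd.
  by move=> cvg_we; apply: no_cvg; exists e.
- have /card_gt0P[E EG] := Gedge.
  pose e : edge G := exist (fun E => E \in edges G) E EG.
  case=> /(_ e)[_ we_oo] /(_ e)[_ [l _ we_l]].
  have [N _ gtl] := (cvgryPgt _).1 we_oo l.
  have := nondecreasing_cvgn_le (nd e) (cvgP _ we_l) N.
  by rewrite (cvg_lim _ we_l)// leNgt; have /= -> := gtl N (leqnn N).
- move=> cvg_w e; apply: (flow_entropy_cvg0 s_gt0 flow_w).
  by have [_ [l _ we_l]] := cvg_w e; apply: cvgP we_l.
Qed.
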